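(* Let $\mathsf a=(\mathsf a_{\ell,\ell'})_{\ell,\ell'\ge0}$, $\mathsf b=(\mathsf b_\ell)_{\ell\ge0}$, $\mathsf d=(\mathsf d_{\ell,\ell'})_{\ell,\ell'\ge0}$, $\mathsf e=(\mathsf e_\ell)_{\ell\ge0}$ be indeterminates, and for $n\ge0$ define $$B_n(\mathsf a,\mathsf b,\mathsf d,\mathsf e)=\sum_{\pi\in\Pi_n}\;\prod_{i\in\mathrm{openers}}\mathsf a_{\mathrm{cr}(i,\pi),\,\mathrm{ne}(i,\pi)}\prod_{i\in\mathrm{closers}}\mathsf b_{\mathrm{qne}(i,\pi)}\prod_{i\in\mathrm{insiders}}\mathsf d_{\mathrm{cr}(i,\pi),\,\mathrm{ne}(i,\pi)}\prod_{i\in\mathrm{singletons}}\mathsf e_{\mathrm{qne}(i,\pi)},$$ $$B^{(3)}_n(\mathsf a,\mathsf b,\mathsf d,\mathsf e)=\sum_{\pi\in\Pi_n}\;\prod_{i\in\mathrm{openers}}\mathsf a_{\mathrm{ov}(i,\pi),\,\mathrm{cov}(i,\pi)}\prod_{i\in\mathrm{closers}}\mathsf b_{\mathrm{qne}(i,\pi)}\prod_{i\in\mathrm{insiders}}\mathsf d_{\mathrm{cr}(i,\pi),\,\mathrm{ne}(i,\pi)}\prod_{i\in\mathrm{singletons}}\mathsf e_{\mathrm{qne}(i,\pi)},$$ $$B^{(4)}_n(\mathsf a,\mathsf b,\mathsf d,\mathsf e)=\sum_{\pi\in\Pi_n}\;\prod_{i\in\mathrm{openers}}\mathsf a_{\mathrm{cr}(i,\pi),\,\mathrm{ne}(i,\pi)}\prod_{i\in\mathrm{closers}}\mathsf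 b_{\mathrm{qne}(i,\pi)}\prod_{i\in\mathrm{insiders}}\mathsf d_{\mathrm{ov}(i,\pi),\,\mathrm{cov}(i,\pi)}\prod_{i\in\mathrm{singletons}}\mathsf e_{\mathrm{qne}(i,\pi)}.$$ Then $B^{(3)}_n(\mathsf a,\mathsf b,\mathsf d,\mathsf e)=B^{(4)}_n(\mathsf a,\mathsf b,\mathsf d,\mathsf e)=B_n(\mathsf a,\mathsf b,\mathsf d,\mathsf e)$ for all $n\ge0$. In particular, the ordinary generating functions $\sum_{n\ge0}B^{(3)}_n(\mathsf a,\mathsf b,\mathsf d,\mathsf e)\,t^n$ and $\sum_{n\ge0}B^{(4)}_n(\mathsf a,\mathsf b,\mathsf d,\mathsf e)\,t^n$ are both equal to $$\cfrac{1}{1-\gamma_0 t-\cfrac{\beta_1t^2}{1-\gamma_1t-\cfrac{\beta_2t^2}{1-\gamma_2 t-\cdots}}}$$ with coefficients $\gamma_n=\mathsf d^\star_{n-1}+\mathsf e_n$ ($n\ge0$) and $\beta_n=\mathsf a^\star_{n-1}\,\mathsf b_{n-1}$ ($n\ge1$), where $\mathsf a^\star_{n-1}=\sum_{\ell=0}^{n-1}\mathsf a_{\ell,n-1-\ell}$ and likewise for $\mathsf d$ (so $\mathsf d^\star_{-1}=0$).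
   Context: $\Pi_n$ is the set of partitions of $[n]=\{1,\dots,n\}$ into nonempty blocks. Continued fractions are identities of formal power series in $t$. For $\pi\in\Pi_n$, an element $i\in[n]$ is an opener if it is the smallest element of a block of size $\ge2$; a closer if it is the largest element of a block of size $\ge2$; an insider if it is a non-opener non-closer element of a block of size $\ge3$; a singleton if it is the sole element of a block of size 1. $\mathcal G_\pi$ is the graph on vertex set $[n]$ whose edges join consecutive elements within the same block; edges are written $(i,j)$ with $i<j$. For $j\in[n]$ define $\mathrm{cr}(j,\pi)=\#\{i<j<k<l:\ (i,k)\in\mathcal G_\pi,\ (j,l)\in\mathcal G_\pi\}$, $\mathrm{ne}(j,\pi)=\#\{i<j<k<l:\ (i,l)\in\mathcal G_\pi,\ (j,k)\in\mathcal G_\pi\}$, $\mathrm{qne}(j,\pi)=\#\{i<j<l:\ (i,l)\in\mathcal G_\pi\}$ (in each case $j$ is fixed and the other indices vary). With $B_1,B_2$ ranging over blocks of $\pi$, define also $\mathrm{ov}(j,\pi)=\#\{(B_1,B_2):\ j\in B_2\text{ and }\min B_1<j<\max B_1<\max B_2\}$, $\mathrm{cov}(j,\pi)=\#\{(B_1,B_2):\ j\in B_2\text{ and }\min B_1<j<\max B_2<\max B_1\}$. *)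

(* Defs.v *)
From HB Require Import structures.
From mathcomp Require Import all_boot all_order all_algebra.

Set Implicit Arguments.
Unset Strict Implicit.
Unset Printing Implicit Defensive.

Import Order.TTheory GRing.Theory.

(* The set [n] = {1, ..., n} is represented by 'I_n = {0, ..., n-1}; every
   notion below depends only on the order of [n], so the shift is harmless. *)

Definition set_partitions (n : nat) : {set {set {set 'I_n}}} :=
  [set P : {set {set 'I_n}} | partition P [set: 'I_n]].

(* Only used on nonempty sets (blocks of partitions): the default values n and
   0 of the empty minimum and maximum never matter. *)
Definition bmin (n : nat) (B : {set 'I_n}) : nat :=
  \big[minn/n]_(i in B) (i : nat).

Definition bmax (n : nat) (B : {set 'I_n}) : nat :=
  \max_(i in B) (i : nat).

Section Statistics.

Variables (n : nat) (P : {set {set 'I_n}}).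
Implicit Types i j k l : 'I_n.

Definition opener i : bool :=
  (2 <= #|pblock P i|) && (bmin (pblock P i) == i).

Definition closer i : bool :=
  (2 <= #|pblock P i|) && (bmax (pblock P i) == i).

Definition insider i : bool :=
  [&& 3 <= #|pblock P i|, ~~ opener i & ~~ closer i].

Definition singleton i : bool := #|pblock P i| == 1.

Definition edge i j : bool :=
  [&& i < j, j \in pblock P i
    & [forall k : 'I_n, (i < k < j) ==> (k \notin pblock P i)]].

(* In cr and ne, u = (i, k, l). *)
Definition cr j : nat :=
  #|[set u : 'I_n * 'I_n * 'I_n |
      let: (i, k, l) := u in
      [&& i < j, j < k, k < l, edge i k & edge j l]]|.

Definition ne j : nat :=
  #|[set u : 'I_n * 'I_n * 'I_n |
      let: (i, k, l) := u in
      [&& i < j, j < k, k < l, edge i l & edge j k]]|.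

Definition qne j : nat :=
  #|[set u : 'I_n * 'I_n |
      let: (i, l) := u in [&& i < j, j < l & edge i l]]|.

Definition ov j : nat :=
  #|[set u : {set 'I_n} * {set 'I_n} |
      let: (B1, B2) := u in
      [&& B1 \in P, B2 \in P, j \in B2,
          bmin B1 < j, j < bmax B1 & bmax B1 < bmax B2]]|.

Definition cov j : nat :=
  #|[set u : {set 'I_n} * {set 'I_n} |
      let: (B1, B2) := u in
      [&& B1 \in P, B2 \in P, j \in B2,
          bmin B1 < j, j < bmax B2 & bmax B2 < bmax B1]]|.

End Statistics.

Local Open Scope ring_scope.

Section Polynomials.

Variable R : comNzRingType.
Variables (a : nat -> nat -> R) (b : nat -> R).
Variables (d : nat -> nat -> R) (e : nat -> R).

Definition Bpoly (n : nat) : R :=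
  \sum_(P in set_partitions n)
     (\prod_(i | opener P i) a (cr P i) (ne P i)) *
     (\prod_(i | closer P i) b (qne P i)) *
     (\prod_(i | insider P i) d (cr P i) (ne P i)) *
     (\prod_(i | singleton P i) e (qne P i)).

Definition Bpoly3 (n : nat) : R :=
  \sum_(P in set_partitions n)
     (\prod_(i | opener P i) a (ov P i) (cov P i)) *
     (\prod_(i | closer P i) b (qne P i)) *
     (\prod_(i | insider P i) d (cr P i) (ne P i)) *
     (\prod_(i | singleton P i) e (qne P i)).

Definition Bpoly4 (n : nat) : R :=
  \sum_(P in set_partitions n)
     (\prod_(i | opener P i) a (cr P i) (ne P i)) *
     (\prod_(i | closer P i) b (qne P i)) *
     (\prod_(i | insider P i) d (ov P i) (cov P i)) *
     (\prod_(i | singleton P i) e (qne P i)).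

Definition star (f : nat -> nat -> R) (m : nat) : R :=
  \sum_(l < m.+1) f l (m - l)%N.

Definition gamma_coef (n : nat) : R :=
  (if n is m.+1 then star d m else 0) + e n.

(* Only meaningful for n >= 1. *)
Definition beta_coef (n : nat) : R := star a n.-1 * b n.-1.

End Polynomials.

(* A formal power series over R in the variable t is identified with its
   sequence of coefficients. *)
Definition fps (R : Type) : Type := nat -> R.

Section FormalPowerSeries.

Variable R : comNzRingType.
Implicit Types f g u : fps R.

Definition fps1 : fps R := fun n => (n == 0)%:R.

Definition fps_mul f g : fps R :=
  fun n => \sum_(i < n.+1) f i * g (n - i)%N.

Fixpoint fps_pow u (j : nat) : fps R :=
  if j is j'.+1 then fps_mul u (fps_pow u j') else fps1.

(* 1 / (1 - u) = \sum_j u ^ j for a series u without constant term; then the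
   terms with j > n do not contribute to the coefficient of t ^ n.  That this
   is the inverse of 1 - u is fps_inv1BP below. *)
Definition fps_inv1B u : fps R :=
  fun n => \sum_(j < n.+1) fps_pow u j n.

Lemma fps_pow_small u j n : u 0%N = 0 -> (n < j)%N -> fps_pow u j n = 0.
Proof.
move=> u0; elim: j n => [//|j IHj] n lt_nj /=.
rewrite /fps_mul big1 // => -[[|i] lt_i] _ /=; first by rewrite u0 mul0r.
rewrite IHj ?mulr0 //; apply: (@leq_trans n) => //.
by rewrite ltn_subrL /=; apply: (@leq_ltn_trans i).
Qed.

Lemma fps_inv1BP u :
  u 0%N = 0 ->
  fps_mul (fun n => fps1 n - u n) (fps_inv1B u) =1 fps1.
Proof.
move=> u0 n; rewrite /fps_mul.
under eq_bigr do rewrite mulrBl.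
rewrite sumrB big_ord_recl /= subn0 mul1r big1 ?addr0; last first.
  by move=> i _; rewrite /fps1 /= mul0r.
have -> : \sum_(i < n.+1) u i * fps_inv1B u (n - i)%N
        = \sum_(j < n.+1) fps_pow u j.+1 n.
  rewrite /= /fps_mul exchange_big /=; apply: eq_bigr => i _.
  rewrite -mulr_sumr; congr (_ * _); rewrite /fps_inv1B.
  rewrite (big_ord_widen n.+1 (fun j => fps_pow u j (n - i)%N)); last first.
    by rewrite ltnS leq_subr.
  rewrite big_mkcond /=; apply: eq_bigr => j _.
  by case: ltnP => // lt_j; rewrite fps_pow_small.
rewrite /fps_inv1B big_ord_recl [X in _ - X]big_ord_recr /=.
rewrite -/(fps_pow u n.+1) (@fps_pow_small u n.+1) // addr0.
by rewrite addrK.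
Qed.

Section JFraction.

Variables (gam bet : nat -> R).

(* Convergents of the J-fraction, with m levels and starting at level k:
   1 / (1 - gam_k t - bet_{k+1} t^2 / (1 - ... / (1 - gam_{k+m-1} t))). *)
Fixpoint jfrac_conv (m k : nat) : fps R :=
  if m is m'.+1 then
    fps_inv1B (fun n => match n with
                        | 0 => 0
                        | 1 => gam k
                        | n'.+2 => bet k.+1 * jfrac_conv m' k.+1 n'
                        end)
  else fun=> 0.

(* The series f is the value of the infinite J-fraction, i.e. the limit of its
   convergents for the t-adic topology: each coefficient is eventually that
   of f. *)
Definition is_jfrac (f : fps R) : Prop :=
  forall n, exists M, forall m, (M <= m)%N -> jfrac_conv m 0 n = f n.

End JFraction.

End FormalPowerSeries.

(* Main.v *)
Require Import Defs.
From HB Require Import structures.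
From mathcomp Require Import all_boot all_order all_algebra.
From mathcomp Require Import ring.
Set Implicit Arguments.
Unset Strict Implicit.
Unset Printing Implicit Defensive.
Import Order.TTheory GRing.Theory.
Local Open Scope ring_scope.

(** The three polynomials are compared with one another, and with the continued
    fraction, by summing over weighted Motzkin paths.

    Read a partition from left to right and record the number h of blocks that
    are currently open (already entered, not yet completed).  An opener raises
    h, a closer lowers it, insiders and singletons keep it, so the partition
    draws a Motzkin path.  At an opener or insider i lying in a block B, let
    the other blocks passing over i be ranked against B, either by the next
    element after i or by the last element.  In the first ranking, the blocks
    ranked lower and higher than B are counted by cr and ne; in the second one
    they are counted by ov and cov.  Either way the two counts add up to the
    number of passing blocks, which is also the value of qne at closers and
    singletons.

    Building the partition from right to left shows that each ranking yields
    the same sum.  Once everything to the right of i is built, i has to join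
    one of the blocks already waiting for a smaller element, and any choice is
    possible.  As the choice varies, the rank of the chosen block takes every
    value exactly once, whichever injective key is used for ranking, and the
    key may even depend on whether i is an opener or an insider.  Hence an
    opener contributes a star and an insider d star in all the cases.

    The right-to-left construction is carried out on marked partitions
    (Q, O): Q partitions a final segment of [n] and O consists of the blocks
    that wait for a smaller element.  Adding a new least element x amounts to
    choosing a block in O, or no block, and deciding whether the enlarged block
    waits in turn (sum_marked_grow).  The weights of the elements already
    present are unchanged (weight_later), and the weight of x is a function of
    the rank of the chosen block (weight_new); total_step is the resulting
    recurrence, which is the recurrence of Motzkin paths.  Finally, the
    first-passage decomposition of paths gives the J-fraction (Flajolet). *)

(** * Motzkin paths and J-fractions *)

Section MotzkinPaths.
Variables (R : comNzRingType) (rise fall lev : nat -> R).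

(** Weighted count of the n-step paths that start h levels above a floor k, end
    on the floor and never go below it.  A level step or a rise from height m
    weighs lev m or rise m, and a fall from m.+1 to m weighs fall m. *)
Fixpoint motzkin (k n h : nat) : R :=
  if n is n'.+1 then
    lev (k + h)%N * motzkin k n' h
    + (if h is h'.+1 then fall (k + h')%N * motzkin k n' h' else 0)
    + rise (k + h)%N * motzkin k n' h.+1
  else (h == 0)%:R.

(** Such a path first reaches the floor k by a fall from k.+1; what precedes
    this fall is a path of height at least k.+1. *)
Lemma motzkin_first_passage k n h :
  motzkin k n h.+1
  = \sum_(i < n) motzkin k.+1 i h * fall k * motzkin k (n.-1 - i)%N 0.
Proof.
elim: n h => [|n IHn] h; first by rewrite big_ord0.
rewrite big_ord_recl /= subn0 (eq_bigr (fun i : 'I_n =>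
   lev (k.+1 + h)%N * (motzkin k.+1 i h * fall k * motzkin k (n.-1 - i)%N 0)
 + (if h is h'.+1 then fall (k.+1 + h')%N *
      (motzkin k.+1 i h' * fall k * motzkin k (n.-1 - i)%N 0) else 0)
 + rise (k.+1 + h)%N *
      (motzkin k.+1 i h.+1 * fall k * motzkin k (n.-1 - i)%N 0))); last first.
  move=> i _; rewrite /bump /= add1n -subn1 subnAC subn1 -subnS.
  have -> : (n - i.+1 = n.-1 - i)%N by rewrite -subn1 -subnDA add1n.
  by case: h => [|h]; ring.
rewrite !big_split /= -!mulr_sumr -!IHn.
have -> : (k + h.+1 = k.+1 + h)%N by rewrite addnS.
case: h => [|h] /=.
  rewrite big1 // !addn0; ring.
by rewrite -mulr_sumr -IHn [(k + h.+1)%N]addnS !addSn; ring.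
Qed.

(** Paths starting on the floor satisfy f = 1 + u f, where 1 - u is the
    denominator of the J-fraction: remove a first level step, or the excursion opened by a
    first rise. *)
Lemma motzkin_convolution k n :
  motzkin k n.+1 0
  = lev k * motzkin k n 0
    + \sum_(i < n) rise k * fall k * motzkin k.+1 i 0
                     * motzkin k (n.-1 - i)%N 0.
Proof.
rewrite /= addr0 addn0 motzkin_first_passage mulr_sumr; congr (_ + _).
by apply: eq_bigr => i _; ring.
Qed.
End MotzkinPaths.

Lemma fps_inv1B_fix (R : comNzRingType) (u : fps R) n : u 0%N = 0 ->
  fps_inv1B u n.+1 = \sum_(i < n.+1) u i.+1 * fps_inv1B u (n - i)%N.
Proof.
move=> u0; have /eqP := fps_inv1BP u0 n.+1.
rewrite /fps_mul /fps1 big_ord_recl /= u0 subr0 mul1r subn0 addr_eq0 => /eqP->.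
rewrite -sumrN; apply: eq_bigr => i _.
by rewrite /bump /= add1n subSS sub0r mulNr opprK.
Qed.

Lemma fps_inv1B_0 (R : comNzRingType) (u : fps R) : fps_inv1B u 0%N = 1.
Proof. by rewrite /fps_inv1B big_ord1. Qed.

(** The equation f = 1 + u f determines f degree by degree, and the convergent
    with m levels satisfies it with u correct up to degree m.  The bound n < m
    is not sharp, but it is the one that induction on m preserves easily. *)
Lemma jfrac_convE (R : comNzRingType) (rise fall lev bet : nat -> R) :
  (forall k, bet k.+1 = rise k * fall k) ->
  forall m k n, (n < m)%N ->
  jfrac_conv lev bet m k n = motzkin rise fall lev k n 0.
Proof.
move=> betE; elim=> [//|m IHm] k n; rewrite [jfrac_conv]lock.
elim/ltn_ind: n => -[|n] IHn lt_nm; rewrite -lock /=.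
  by rewrite fps_inv1B_0.
rewrite fps_inv1B_fix // big_ord_recl /= subn0 -/(jfrac_conv _ _ m.+1 k _).
have conv_n' n' : (n' <= n)%N ->
    jfrac_conv lev bet m.+1 k n' = motzkin rise fall lev k n' 0.
  by move=> le_n'; rewrite [jfrac_conv]lock IHn // (leq_ltn_trans le_n') // ltnW.
have := motzkin_convolution rise fall lev k n; rewrite /= => ->.
rewrite -[fps_inv1B _ n]/(jfrac_conv lev bet m.+1 k n) conv_n' //; congr (_ + _).
apply: eq_bigr => i _; congr (_ * _ * _); first exact: betE.
  rewrite IHm //; apply: leq_trans (ltn_ord i) _.
  by rewrite ltnS in lt_nm; exact: ltnW.
rewrite /bump /= add1n.
have -> : (n - i.+1 = n.-1 - i)%N by rewrite -subn1 -subnDA add1n.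
rewrite -[LHS]/(jfrac_conv lev bet m.+1 k _) conv_n' //.
by rewrite (leq_trans (leq_subr _ _)) ?leq_pred.
Qed.

Lemma motzkin_jfrac (R : comNzRingType) (rise fall lev bet : nat -> R) :
  (forall k, bet k.+1 = rise k * fall k) ->
  is_jfrac lev bet (fun n => motzkin rise fall lev 0 n 0).
Proof.
by move=> betE n; exists n.+1 => m lt_nm; apply: jfrac_convE.
Qed.

(** * Ranks *)

(** An injective key ranks the elements of A by 0, ..., #|A|.-1, each rank being
    taken once.  The induction removes the element with the largest key. *)
Lemma card_ltn_below (T : finType) (A : {set T}) (key : T -> nat)
    (R : nmodType) (g : nat -> R) :
  {in A &, injective key} ->
  \sum_(B in A) g #|[set C in A | (key C < key B)%N]| = \sum_(l < #|A|) g l.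
Proof.
move: {2}#|A| (erefl #|A|) => m; elim: m A => [|m IHm] A cardA inj_key.
  by rewrite cardA big_ord0 (cards0_eq cardA) big_set0.
have /card_gt0P[B0 AB0] : (0 < #|A|)%N by rewrite cardA.
have [top /= Atop key_max] := @arg_maxnP _ B0 (mem A) key AB0.
have key_lt B : B \in A :\ top -> (key B < key top)%N.
  case/setD1P=> ntop AB; rewrite ltn_neqAle (key_max _ AB : (key B <= key top)%N) andbT.
  by apply: contraNneq ntop => /inj_key->.
have cardA' : #|A :\ top| = m by move: cardA; rewrite (cardsD1 top) Atop => -[].
rewrite cardA big_ord_recr /= (big_setD1 top) //= addrC; congr (_ + _); last first.
  congr (g _); rewrite -cardA'; apply: eq_card => C; rewrite !inE.
  have [->|ntop] /= := eqVneq C top; first by rewrite ltnn andbF.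
  by apply: andb_idr => AC; apply: key_lt; rewrite !inE ntop.
rewrite -cardA' -IHm //; last first.
  by move=> B C /setD1P[_ AB] /setD1P[_ AC]; apply: inj_key.
apply: eq_bigr => B A'B; congr (g _); apply: eq_card => C; rewrite !inE.
have [->|//] := eqVneq C top.
by rewrite ltnNge (ltnW (key_lt _ A'B)) andbF.
Qed.

(** The origin of the star coefficients: the numbers of smaller and of larger
    keys run over the pairs with sum #|O|.-1. *)
Lemma sum_ranks (T : finType) (O : {set T}) (key : T -> nat)
    (R : comNzRingType) (f : nat -> nat -> R) :
  {in O &, injective key} ->
  \sum_(B in O) f #|[set C in O | (key C < key B)%N]|
                  #|[set C in O | (key B < key C)%N]|
  = if #|O| is m.+1 then star f m else 0.
Proof.
move=> inj_key.
transitivity (\sum_(l < #|O|) f l (#|O|.-1 - l)%N); last first.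
  by case: #|O| => [|m]; rewrite ?big_ord0.
rewrite -(card_ltn_below (fun l => f l (#|O|.-1 - l)%N) inj_key).
apply: eq_bigr => B OB; congr (f _ _); rewrite (cardsD1 B O) OB add1n succnK.
rewrite -(cardsID [set C | (key C < key B)%N] (O :\ B)).
have -> : (O :\ B) :&: [set C | (key C < key B)%N] = [set C in O | (key C < key B)%N].
  apply/setP=> C; rewrite !inE; have [->|//] := eqVneq C B.
  by rewrite ltnn !andbF.
rewrite addKn; apply: eq_card => C; rewrite !inE -leqNgt.
have [->|CB] := eqVneq C B; first by rewrite ltnn !andbF.
case: (boolP (C \in O)) => OC; rewrite ?andbF //= andbT ltn_neqAle.
by apply: andb_idl => _; apply: contra_neq CB => /inj_key->.
Qed.

(** * Marked partitions *)

Section MarkedPartitions.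
Variable n : nat.
Definition mpart := ({set {set 'I_n}} * {set {set 'I_n}})%type.
Implicit Types (B C : {set 'I_n}) (s : mpart) (i x : 'I_n).

Definition from k : {set 'I_n} := [set i : 'I_n | (k <= i)%N].
Definition marked k s := partition s.1 (from k) && (s.2 \subset s.1).

(** A mark promises an element on the left of the whole segment, so a marked
    block counts as started everywhere. *)
Definition started s C i := (C \in s.2) || [exists c in C, (c < i)%N].
Definition rest C i := [set c in C | (i < c)%N].
(** The blocks C with an arc over i, including the arc that will link a marked
    block to its future smaller element. *)
Definition passing s i :=
  [set C in s.1 | [&& i \notin C, started s C i & rest C i != set0]].
Definition before (key : {set 'I_n} -> nat) s i :=
  [set C in passing s i | (key (rest C i) < key (rest (pblock s.1 i) i))%N].
Definition behind (key : {set 'I_n} -> nat) s i :=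
  [set C in passing s i | (key (rest (pblock s.1 i) i) < key (rest C i))%N].

(** Adds the new least element x to the waiting block B, where B = set0 means
    that x forms a block of its own; mark tells whether the block of x waits for
    a smaller element.  As set0 is not a block, removing it has no effect, which
    avoids a case distinction. *)
Definition grow x B (mark : bool) s : mpart :=
  ((x |: B) |: s.1 :\ B,
   if mark then (x |: B) |: s.2 :\ B else s.2 :\ B).
(** Removes the least element x.  What is left of its block becomes a waiting
    block, unless it is empty. *)
Definition shrink x s : mpart :=
  let B := pblock s.1 x in
  (((B :\ x) |: s.1 :\ B) :\ set0, ((B :\ x) |: s.2 :\ B) :\ set0).

Lemma from_split x : from x = x |: from x.+1.
Proof. by apply/setP=> i; rewrite !inE leq_eqVlt eq_sym. Qed.

Lemma marked_gt x s C c : marked x.+1 s -> C \in s.1 -> c \in C -> (x < c)%N.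
Proof.
by case/andP=> part_s _ sC /(subsetP (partitionS part_s sC)); rewrite inE.
Qed.

Lemma marked_notin x s C : marked x.+1 s -> C \in s.1 -> x \notin C.
Proof.
by move=> ms sC; apply/negP=> /(marked_gt ms sC); rewrite ltnn.
Qed.

Lemma marked_neq0 k s C : marked k s -> C \in s.1 -> C != set0.
Proof. by case/andP=> /partition_neq0 H _ /H. Qed.

Lemma marked_pblock k s C i : marked k s -> C \in s.1 -> i \in C -> pblock s.1 i = C.
Proof. by case/andP=> /partition_trivIset tI _; apply: def_pblock. Qed.

Lemma setU1_eq0 (T : finType) (y : T) (A : {set T}) : (y |: A == set0) = false.
Proof. by apply/negbTE/set0Pn; exists y; rewrite setU11. Qed.

Lemma setD1_id (T : finType) (y : T) (A : {set T}) : y \notin A -> A :\ y = A.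
Proof. by move=> A'y; apply/setDidPl; rewrite disjoint_sym disjoints1. Qed.

Lemma target_sub s B : s.2 \subset s.1 -> B \in set0 |: s.2 -> B != set0 -> B \in s.1.
Proof. by move=> /subsetP s21 /setU1P[->|/s21 //]; rewrite eqxx. Qed.

Lemma marked_grow x B mark s :
  marked x.+1 s -> B \in set0 |: s.2 -> marked x (grow x B mark s).
Proof.
move=> ms tB; have /andP[part_s s21] := ms; apply/andP; split; last first.
  case: mark => /=; first by rewrite setUS // setSD.
  exact: subset_trans (setSD _ s21) (subsetUr _ _).
have sBx : B \subset from x.+1.
  have [->|B0] := eqVneq B set0; first exact: sub0set.
  exact/(partitionS part_s)/target_sub.
have -> : from x = (x |: B) :|: (from x.+1 :\: B).
  rewrite from_split -setUA; congr (_ |: _); apply/setP=> i; rewrite in_setU in_setD.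
  by case: (boolP (i \in B)) => [/(subsetP sBx)->|].
apply: partitionU1; rewrite ?setU1_eq0 //; last first.
  rewrite disjoints_subset; apply/subsetP=> i; rewrite !inE.
  by case/orP=> [/eqP-> |->]; rewrite ?ltnn ?andbF.
have [->|B0] := eqVneq B set0; last exact/partitionD1/target_sub.
by rewrite setD0 setD1_id ?(partition0 part_s).
Qed.

Lemma least_block x s (B := pblock s.1 x) : partition s.1 (from x) ->
  [/\ B \in s.1, x \in B & B :\ x != set0 -> B :\ x \notin s.1].
Proof.
move=> part_s.
have covx : x \in cover s.1 by rewrite (cover_partition part_s) inE.
have sB : B \in s.1 by rewrite pblock_mem.
have Bx : x \in B by rewrite mem_pblock.
split=> // B0; apply/negP=> sB'; case/set0Pn: B0 => c B'c.
have eqB := def_pblock (partition_trivIset part_s).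
have := setD11 x B.
by rewrite -(eqB _ c sB' B'c) (eqB B) ?Bx //; case/setD1P: B'c.
Qed.

Lemma marked_shrink x s : marked x s ->
  marked x.+1 (shrink x s) /\ pblock s.1 x :\ x \in set0 |: (shrink x s).2.
Proof.
case/andP=> part_s s21; set B := pblock s.1 x.
have [sB Bx B'0] := least_block part_s.
have fromE : from x.+1 = (B :\ x) :|: (from x :\: B).
  rewrite from_split; apply/setP=> i; rewrite !inE.
  have [->|ix] := eqVneq i x; first by rewrite ltnn Bx.
  case: (boolP (i \in B)) => //= /(subsetP (partitionS part_s sB)).
  by rewrite inE leq_eqVlt eq_sym (inj_eq val_inj) (negbTE ix) /= => ->.
split; last by rewrite !inE eqxx; case: eqP.
apply/andP; split; last by rewrite setSD // setUS // setSD.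
rewrite /= -/B; have partD := partitionD1 part_s sB.
have [B0|B0] := eqVneq (B :\ x) set0.
  rewrite fromE B0 set0U setU1K ?(partition0 partD) //.
rewrite fromE setD1_id; last first.
  by rewrite !inE (partition0 part_s) andbF orbF eq_sym.
apply: partitionU1 => //; rewrite disjoints_subset; apply/subsetP=> i.
by rewrite !inE => /andP[_ ->].
Qed.

Lemma target_notin x s B : marked x.+1 s -> B \in set0 |: s.2 -> x \notin B.
Proof.
move=> ms tB; have [->|B0] := eqVneq B set0; first by rewrite inE.
by apply: (marked_notin ms (target_sub _ tB B0)); case/andP: ms.
Qed.

Lemma grown_new x s B : marked x.+1 s -> (x |: B) \notin s.1.
Proof. by move=> ms; apply/negP=> /(marked_notin ms); rewrite setU11. Qed.

Lemma grown_marked x B mark s : marked x.+1 s ->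
  (x |: B \in (grow x B mark s).2) = mark.
Proof.
move=> ms; case: mark => /=; first by rewrite setU11.
have /negbTE xBs2 : x |: B \notin s.2.
  by apply: contra (grown_new B ms); apply/subsetP; case/andP: ms.
by rewrite inE xBs2 andbF.
Qed.

Lemma growK x B mark s : marked x.+1 s -> B \in set0 |: s.2 ->
  shrink x (grow x B mark s) = s
  /\ pblock (grow x B mark s).1 x = x |: B.
Proof.
move=> ms tB; have mg := marked_grow mark ms tB.
have xgB : (x |: B) \in (grow x B mark s).1 by rewrite setU11.
have s21 : s.2 \subset s.1 by case/andP: ms.
have xNB := target_notin ms tB.
have pbx : pblock (grow x B mark s).1 x = x |: B.
  by apply: marked_pblock mg xgB _; rewrite setU11.
have xB' : (x |: B) \notin s.1.
  by apply/negP=> /(marked_notin ms); rewrite setU11.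
have s0 : set0 \notin s.1 by apply/negP=> /(marked_neq0 ms); rewrite eqxx.
rewrite /shrink pbx setU1K //; split=> //.
case: s ms tB {mg pbx} s21 xB' s0 xgB => Q O /= ms tB OQ xB' s0 _.
have back (A : {set {set 'I_n}}) : A \subset Q -> (B != set0 -> B \in A) ->
    (B |: A :\ B) :\ set0 = A.
  move=> AQ AB; have A0 : set0 \notin A by apply: contra s0; apply/subsetP.
  have [->|B0] := eqVneq B set0; first by rewrite setU1K ?setD1_id ?inE ?eqxx.
  by rewrite setD1K ?AB // setD1_id.
have xBO : (x |: B) \notin O by apply: contra xB'; apply/subsetP.
have dropx (A : {set {set 'I_n}}) : (x |: B) \notin A ->
    ((x |: B) |: A :\ B) :\ (x |: B) = A :\ B.
  by move=> AxB; rewrite setU1K // !inE negb_and AxB orbT.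
have BO : B != set0 -> B \in O.
  by move=> B0; case/setU1P: tB B0 => // ->; rewrite eqxx.
congr (_, _).
  by rewrite dropx // back // => /BO; apply: (subsetP OQ).
by case: mark; rewrite ?dropx ?[_ :\ (x |: B)]setD1_id ?back // !inE negb_and xBO orbT.
Qed.

Lemma shrinkK x s : marked x s ->
  grow x (pblock s.1 x :\ x) (pblock s.1 x \in s.2) (shrink x s) = s.
Proof.
case/andP=> part_s s21; set B := pblock s.1 x.
have [sB Bx B'0] := least_block part_s.
have drop (A : {set {set 'I_n}}) : A \subset s.1 ->
    (B :\ x |: A :\ B) :\ set0 :\ (B :\ x) = A :\ B.
  move=> As; apply/setP=> C; rewrite !inE.
  have [->|_] := eqVneq C (B :\ x); last first.
    have [->|] := eqVneq C set0; rewrite //= (contraNF (subsetP As _)) ?andbF //.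
    by rewrite (partition0 part_s).
  rewrite /=; apply/esym/negbTE; rewrite negb_and; apply/orP; right.
  have [->|/B'0] := eqVneq (B :\ x) set0; last by apply: contra => /(subsetP As).
  by apply: contraFN (partition0 part_s) => /(subsetP As).
rewrite /grow /= -/B !drop // [x |: _]setD1K // [B |: s.1 :\ B]setD1K //.
by case: ifP => OB; rewrite ?[B |: _]setD1K ?[s.2 :\ B]setD1_id ?OB //
  -surjective_pairing.
Qed.

(** The heart of the bijection: a marked partition with least element x arises
    by grow from exactly one smaller one and one choice of B and mark. *)
Lemma sum_marked_grow (R : nmodType) x (F : mpart -> R) :
  \sum_(s | marked x s) F s
  = \sum_(s | marked x.+1 s) \sum_(B in set0 |: s.2) \sum_(mark : bool)
      F (grow x B mark s).
Proof.
under [RHS]eq_bigr do rewrite pair_big_dep /=.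
rewrite pair_big_dep /=.
pose decomp s := (shrink x s, (pblock s.1 x :\ x, pblock s.1 x \in s.2)).
rewrite (reindex_onto (fun q => grow x q.2.1 q.2.2 q.1) decomp) /=; last first.
  by move=> s; apply: shrinkK.
apply: eq_bigl => -[s [B mark]] /=; rewrite andbT.
apply/andP/andP => [[mg /eqP]|[ms tB]].
  by case=> eq_s eq_B _; have := marked_shrink mg; rewrite eq_s eq_B => -[].
split; first exact: marked_grow.
rewrite /decomp; have [-> ->] := growK mark ms tB.
by rewrite setU1K ?(target_notin ms tB) // grown_marked.
Qed.

(** Statistics of s are cardinals of sets of blocks.  Growing replaces B by
    x |: B, so such a cardinal is kept as soon as the predicates correspond; the
    condition on set0 covers the case where x forms a new block. *)
Lemma card_grow x B mark s (F G : pred {set 'I_n}) :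
  marked x.+1 s -> B \in set0 |: s.2 ->
  G (x |: B) = F B -> F set0 = false ->
  {in s.1, forall C, C != B -> G C = F C} ->
  #|[set C in (grow x B mark s).1 | G C]| = #|[set C in s.1 | F C]|.
Proof.
move=> ms tB GB F0 GF; have s21 : s.2 \subset s.1 by case/andP: ms.
rewrite -!sum1dep_card !big_mkcondr /= big_setU1 /=; last first.
  by rewrite inE negb_and (grown_new B ms) orbT.
rewrite GB (eq_bigr (fun C => if F C then 1 else 0)%N); last first.
  by move=> C /setD1P[CB sC]; rewrite GF.
have [B0|B0] := eqVneq B set0; last first.
  by rewrite [RHS](big_setD1 B) // (target_sub s21 tB).
rewrite B0 F0 setD1_id //.
by apply/negP=> /(marked_neq0 ms); rewrite eqxx.
Qed.

Lemma rest_grown x B i : (x < i)%N -> rest (x |: B) i = rest B i.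
Proof.
move=> xi; apply/setP=> c; rewrite !inE.
by have [->|] := eqVneq c x; rewrite //= ltnNge (ltnW xi) !andbF.
Qed.

Lemma rest0 i : rest set0 i = set0.
Proof. by apply/setP=> c; rewrite !inE. Qed.

(** How i sees the blocks when an element x smaller than i is added: nothing to
    the right of i changes, and the block joined by x was already started, by its
    mark before x is added and by x itself afterwards. *)
Section Later.
Variables (x : 'I_n) (B : {set 'I_n}) (mark : bool) (s : mpart) (i : 'I_n).
Hypotheses (ms : marked x.+1 s) (tB : B \in set0 |: s.2) (xi : (x < i)%N).
Let g := grow x B mark s.

Lemma started_grown : started g (x |: B) i.
Proof.
by apply/orP; right; apply/existsP; exists x; rewrite setU11.
Qed.

Lemma started_target : rest B i != set0 -> started s B i.
Proof.
move=> r0; case/setU1P: tB => [B0|sB]; last by apply/orP; left.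
by rewrite B0 rest0 eqxx in r0.
Qed.

Lemma started_grow_other C : C \in s.1 -> C != B -> started g C i = started s C i.
Proof.
move=> sC CB; rewrite /started; congr (_ || _).
have CxB : C != x |: B by apply: contraTneq sC => ->; apply: grown_new.
by rewrite /g /grow; case: mark; rewrite /= !inE (negbTE CB) ?(negbTE CxB).
Qed.

Lemma pblock_grow :
  rest (pblock g.1 i) i = rest (pblock s.1 i) i
  /\ started g (pblock g.1 i) i = started s (pblock s.1 i) i.
Proof.
have mg := marked_grow mark ms tB; have /andP[part_s s21] := ms.
have covi : i \in cover s.1 by rewrite (cover_partition part_s) inE.
have [/eqP eqB|neqB] := boolP (pblock s.1 i == B).
  have Bi : i \in B by rewrite -eqB mem_pblock.
  rewrite (marked_pblock (C := x |: B) mg) ?setU11 ?inE ?Bi ?orbT //.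
  rewrite eqB rest_grown // started_grown; split=> //.
  case/setU1P: tB => [B0|sB]; first by rewrite B0 inE in Bi.
  by rewrite /started sB.
have sC := pblock_mem covi.
rewrite (marked_pblock (C := pblock s.1 i) mg) ?mem_pblock //; last first.
  by rewrite /g /= !inE neqB sC orbT.
by rewrite started_grow_other.
Qed.

Lemma card_passing_grow (K : pred {set 'I_n}) :
  #|[set C in passing g i | K (rest C i)]| = #|[set C in passing s i | K (rest C i)]|.
Proof.
have setE t : [set C in passing t i | K (rest C i)] = [set C in t.1 |
    [&& i \notin C, started t C i, rest C i != set0 & K (rest C i)]].
  by apply/setP=> C; rewrite !inE -!andbA.
rewrite !setE; apply: card_grow => //.
- have /negbTE ix : i != x by apply: contraTneq xi => ->; rewrite ltnn.
  rewrite started_grown rest_grown // !inE ix /=.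
  by case: (boolP (rest B i == _)) => [|/started_target->] //=; rewrite !andbF.
- by rewrite rest0 eqxx !andbF.
- by move=> C sC CB; rewrite started_grow_other.
Qed.
End Later.

Lemma rest_full x C : {in C, forall c : 'I_n, (x < c)%N} -> rest C x = C.
Proof. by move=> Cx; apply/setP=> c; rewrite inE; apply: andb_idr => /Cx. Qed.

Lemma rest_new x B s : marked x.+1 s -> B \in set0 |: s.2 -> rest (x |: B) x = B.
Proof.
move=> ms tB; have xB := target_notin ms tB.
have -> : rest (x |: B) x = rest B x.
  by apply/setP=> c; rewrite !inE; case: eqVneq => [->|]; rewrite ?ltnn ?andbF.
case/setU1P: tB => [->|sB]; first by rewrite rest0.
apply: rest_full => c; apply: (marked_gt ms).
by case/andP: ms => _ /subsetP; apply.
Qed.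

Lemma started_new x B mark s : marked x.+1 s -> B \in set0 |: s.2 ->
  started (grow x B mark s) (x |: B) x = mark.
Proof.
move=> ms tB; rewrite /started grown_marked //; apply: orb_idr => /existsP[c].
rewrite !inE => /andP[/orP[/eqP->|Bc]]; first by rewrite ltnn.
case/setU1P: tB Bc => [->|sB Bc]; first by rewrite inE.
have sB1 : B \in s.1 by case/andP: ms => _ /subsetP; apply.
by rewrite ltnNge (ltnW (marked_gt ms sB1 Bc)).
Qed.

(** At the least element x, only the blocks that wait for a smaller element can
    pass over x. *)
Lemma passing_new x B mark s : marked x.+1 s -> B \in set0 |: s.2 ->
  passing (grow x B mark s) x = s.2 :\ B.
Proof.
move=> ms tB; apply/setP=> C; rewrite inE.
have s21 : s.2 \subset s.1 by case/andP: ms.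
have [->|CxB] := eqVneq C (x |: B).
  have -> : x \in x |: B by rewrite setU11.
  rewrite andbF; apply/esym/negbTE; rewrite inE negb_and orbC.
  by rewrite (contra _ (grown_new B ms)) //; apply: (subsetP s21).
have -> : (C \in (grow x B mark s).1) = (C != B) && (C \in s.1).
  by rewrite /= !inE (negbTE CxB).
rewrite [RHS]inE inE.
have [//|CB] := eqVneq C B; rewrite /=.
case: (boolP (C \in s.1)) => [sC|s'C]; last first.
  by apply/esym/negbTE; apply: contra s'C; apply: (subsetP s21).
rewrite /=.
have Cx c : c \in C -> (x < c)%N by apply: (marked_gt ms sC).
rewrite (marked_notin ms sC) rest_full // (marked_neq0 ms sC) andbT /= /started.
have -> : [exists c in C, (c < x)%N] = false.
  apply/negbTE/existsPn=> c; rewrite negb_and -leqNgt.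
  by case: (boolP (c \in C)) => //= /Cx/ltnW.
by rewrite /grow orbF; case: mark; rewrite /= !inE (negbTE CB) ?(negbTE CxB).
Qed.

Lemma card_grow_marked x B mark s : marked x.+1 s ->
  #|(grow x B mark s).2| = (mark + #|s.2 :\ B|)%N.
Proof.
move=> ms; case: mark => //=; rewrite cardsU1 inE.
suff /negbTE-> : x |: B \notin s.2 by rewrite andbF.
by apply: contra (grown_new B ms); apply/subsetP; case/andP: ms.
Qed.

(** * Weights and their recurrence *)

(** Keys such as the minimum and the maximum.  Since blocks are disjoint, such
    a key is injective on the blocks of a partition. *)
Definition selects (key : {set 'I_n} -> nat) :=
  forall B, B != set0 -> exists2 j : 'I_n, j \in B & key B = j.

Lemma selects_inj key k s : selects key -> marked k s -> {in s.1 &, injective key}.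
Proof.
move=> sel ms B C sB sC eq_key.
have [j Bj keyB] := sel B (marked_neq0 ms sB).
have [j' Cj keyC] := sel C (marked_neq0 ms sC).
have ejj' : j = j' by apply: val_inj; rewrite /= -keyB eq_key.
by rewrite -(marked_pblock ms sB Bj) -(marked_pblock ms sC Cj) ejj'.
Qed.

Section Weights.
Variables (R : comNzRingType) (key_a key_d : {set 'I_n} -> nat).
Variables (a : nat -> nat -> R) (b : nat -> R).
Variables (d : nat -> nat -> R) (e : nat -> R).
Hypotheses (sel_a : selects key_a) (sel_d : selects key_d).

(** One formula for the three polynomials.  Openers are ranked by key_a and
    insiders by key_d, the key being applied to the part of each block on the
    right of i: the minimum of that part is the next element of the block, and
    its maximum is the last element of the block. *)
Definition weight s i : R :=
  let B := pblock s.1 i in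
  if rest B i == set0 then (if started s B i then b else e) #|passing s i|
  else if started s B i then d #|before key_d s i| #|behind key_d s i|
  else a #|before key_a s i| #|behind key_a s i|.

Lemma weight_later x B mark s i : marked x.+1 s -> B \in set0 |: s.2 ->
  (x < i)%N -> weight (grow x B mark s) i = weight s i.
Proof.
move=> ms tB xi; rewrite /weight; have [restE ->] := pblock_grow mark ms tB xi.
have cardE K := card_passing_grow mark ms tB xi K.
have passE : #|passing (grow x B mark s) i| = #|passing s i|.
  have all_t t : passing t i = [set C in passing t i | predT (rest C i)].
    by apply/setP=> C; rewrite [RHS]inE andbT.
  by rewrite [in LHS]all_t [in RHS]all_t; apply: cardE.
have beforeE key : #|before key (grow x B mark s) i| = #|before key s i|.
  by rewrite /before restE; apply: (cardE (fun D => (key D < key _)%N)).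
have behindE key : #|behind key (grow x B mark s) i| = #|behind key s i|.
  by rewrite /behind restE; apply: (cardE (fun D => (key _ < key D)%N)).
by rewrite restE passE !beforeE !behindE.
Qed.

(** The weight of x depends on s through its waiting blocks only, and B matters
    only through its rank among them. *)
Lemma weight_new x B mark s : marked x.+1 s -> B \in set0 |: s.2 ->
  weight (grow x B mark s) x =
    if B == set0 then (if mark then b else e) #|s.2|
    else let key := if mark then key_d else key_a in
         (if mark then d else a)
           #|[set C in s.2 | (key C < key B)%N]| #|[set C in s.2 | (key B < key C)%N]|.
Proof.
move=> ms tB; have mg := marked_grow mark ms tB.
have s21 : s.2 \subset s.1 by case/andP: ms.
have xgB : x |: B \in (grow x B mark s).1 by rewrite setU11.
rewrite /weight /before /behind (marked_pblock mg xgB) ?setU11 // started_new //.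
rewrite (rest_new ms tB) (passing_new mark ms tB).
case: eqVneq => [->|B0].
  rewrite setD1_id //; apply/negP=> /(subsetP s21)/(marked_neq0 ms).
  by rewrite eqxx.
have restC C : C \in s.2 -> rest C x = C.
  by move=> /(subsetP s21) sC; apply: rest_full => c; apply: (marked_gt ms sC).
have setE (K : pred {set 'I_n}) : ~~ K B ->
    [set C in s.2 :\ B | K (rest C x)] = [set C in s.2 | K C].
  move=> KB; apply/setP=> C; rewrite !inE.
  have [->|_] := eqVneq C B; first by rewrite (negbTE KB) andbF.
  by case: (boolP (C \in s.2)) => //= /restC->.
have lowE key := setE (fun D => (key D < key B)%N) (negbT (ltnn _)).
have highE key := setE (fun D => (key B < key D)%N) (negbT (ltnn _)).
by case: mark {mg xgB}; rewrite lowE highE.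
Qed.

(** h counts the waiting blocks, that is, the height of the Motzkin path just
    before element k is read. *)
Definition total k h : R :=
  \sum_(s | marked k s) if #|s.2| == h then \prod_(i in from k) weight s i else 0.

(** Joining one of m waiting blocks leaves m or m.-1 of them, with weights adding
    up to star d m.-1 or star a m.-1; starting a new block leaves m.+1 or m of them,
    with weight b m or e m.  The recurrence collects the cases with h left. *)
Lemma total_step x h :
  total x h = gamma_coef d e h * total x.+1 h
    + (if h is h'.+1 then b h' * total x.+1 h' else 0)
    + star a h * total x.+1 h.+1.
Proof.
rewrite /total sum_marked_grow; pose later s := \prod_(i in from x.+1) weight s i.
(* The three terms correspond to the marked partitions s whose number of
   waiting blocks is h, h.-1 or h.+1. *)
transitivity (\sum_(s | marked x.+1 s)
    ((if #|s.2| == h then gamma_coef d e h * later s else 0)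
     + (if #|s.2|.+1 == h then b #|s.2| * later s else 0)
     + (if #|s.2| == h.+1 then star a h * later s else 0))); last first.
  rewrite !big_split /= !mulr_sumr; congr (_ + _ + _).
  - by apply: eq_bigr => s _; case: ifP; rewrite ?mulr0.
  - case: h => [|h]; first by rewrite big1.
    rewrite mulr_sumr; apply: eq_bigr => s _; rewrite eqSS.
    by case: eqP => [->|]; rewrite ?mulr0.
  - by apply: eq_bigr => s _; case: ifP; rewrite ?mulr0.
apply: eq_bigr => s ms; have /andP[_ s21] := ms.
have s2_0 : set0 \notin s.2.
  by apply/negP=> /(subsetP s21)/(marked_neq0 ms); rewrite eqxx.
have prodE B mark : B \in set0 |: s.2 ->
    \prod_(i in from x) weight (grow x B mark s) i
    = weight (grow x B mark s) x * later s.
  move=> tB; rewrite from_split big_setU1 ?inE ?ltnn //=; congr (_ * _).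
  by apply: eq_bigr => i; rewrite inE; apply: weight_later.
have inj_key key : selects key -> {in s.2 &, injective key}.
  move=> /(@selects_inj key x.+1 s)/(_ ms) inj B C /(subsetP s21) sB /(subsetP s21).
  exact: inj.
rewrite big_setU1 // big_bool !card_grow_marked // setD1_id // add1n add0n.
rewrite !prodE ?setU11 // !weight_new ?setU11 // eqxx.
rewrite (eq_bigr (fun B =>
    (if #|s.2| == h then d #|[set C in s.2 | (key_d C < key_d B)%N]|
                           #|[set C in s.2 | (key_d B < key_d C)%N]| else 0) * later s
    + (if #|s.2| == h.+1 then a #|[set C in s.2 | (key_a C < key_a B)%N]|
                           #|[set C in s.2 | (key_a B < key_a C)%N]| else 0)
      * later s));
    last first.
  move=> B sB; have tB : B \in set0 |: s.2 by rewrite inE sB orbT.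
  rewrite big_bool !card_grow_marked // !prodE // !weight_new //.
  rewrite (negbTE (marked_neq0 ms (subsetP s21 _ sB))) (cardsD1 B s.2) sB.
  by rewrite /= !add1n add0n eqSS; do 2 case: ifP => _; rewrite ?mul0r.
rewrite big_split /= -!mulr_suml.
have -> : \sum_(B in s.2) (if #|s.2| == h then
      d #|[set C in s.2 | (key_d C < key_d B)%N]|
        #|[set C in s.2 | (key_d B < key_d C)%N]| else 0)
    = if #|s.2| == h then (if h is m.+1 then star d m else 0) else 0.
  by case: eqP => [<-|_]; rewrite ?sum_ranks ?big1 //; apply: inj_key.
have -> : \sum_(B in s.2) (if #|s.2| == h.+1 then
      a #|[set C in s.2 | (key_a C < key_a B)%N]|
        #|[set C in s.2 | (key_a B < key_a C)%N]| else 0)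
    = if #|s.2| == h.+1 then star a h else 0.
  case: eqP => [eq_h|_]; last by rewrite big1.
  by rewrite sum_ranks ?eq_h //; apply: inj_key.
rewrite /gamma_coef; move: (if h is m.+1 then star d m else 0) (later s) => dh p.
case: (#|s.2| =P h) => [->|_]; case: (_.+1 == h); case: (_ == h.+1).
all: by rewrite ?mul0r ?addr0 ?add0r //; ring.
Qed.

Lemma total_end h : total n h = (h == 0)%:R.
Proof.
have from_n : from n = set0 by apply/setP=> i; rewrite !inE leqNgt ltn_ord.
rewrite /total (big_pred1 (set0, set0)) => [|[Q O]] /=.
  by rewrite cards0 from_n big_set0 eq_sym; case: (h == 0).
rewrite /marked from_n partition_set0 /= xpair_eqE.
by case: eqP => // ->; rewrite subset0.
Qed.

Lemma total_motzkin k h : (k <= n)%N ->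
  total k h = motzkin (star a) b (gamma_coef d e) 0 (n - k) h.
Proof.
move=> le_kn; move: {-1}(n - k)%N (erefl (n - k)%N) => m.
elim: m k le_kn h => [|m IHm] k le_kn h eq_m.
  have -> : k = n by apply/eqP; rewrite eqn_leq le_kn -subn_eq0 eq_m.
  exact: total_end.
have lt_kn : (k < n)%N by rewrite -subn_gt0 eq_m.
have eq_m1 : (n - k.+1)%N = m by rewrite subnS eq_m.
rewrite -[k]/(nat_of_ord (Ordinal lt_kn)) total_step /= !add0n.
by rewrite !IHm //; case: h => [|h]; rewrite ?IHm.
Qed.

Lemma total0 :
  total 0 0 = \sum_(P in set_partitions n) \prod_i weight (P, set0) i.
Proof.
have from0 : from 0 = setT by apply/setP=> i; rewrite !inE.
rewrite /total -big_mkcondr /=.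
rewrite (reindex_onto (fun P => (P, set0)) (fun s => s.1)) /=; last first.
  by move=> [Q O] /= /andP[_]; rewrite cards_eq0 => /eqP->.
apply: eq_big => [P|P _]; last by rewrite from0; apply: eq_bigl => i; rewrite inE.
by rewrite /marked /= cards0 from0 sub0set !eqxx !andbT inE.
Qed.
End Weights.
End MarkedPartitions.

(** * Block minima and maxima *)

Section Extrema.
Variable n : nat.
Implicit Types (C : {set 'I_n}) (c j : 'I_n).

Lemma leq_bmax C c : c \in C -> (c <= bmax C)%N.
Proof. by move=> Cc; rewrite /bmax (bigD1 c) //= leq_maxl. Qed.

Lemma bmin_leq C c : c \in C -> (bmin C <= c)%N.
Proof.
move=> Cc; rewrite /bmin; elim: index_enum (mem_index_enum c) => //= i r IHr.
rewrite big_cons inE => /predU1P[<-|/IHr le_c]; first by rewrite Cc geq_minl.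
by case: ifP; rewrite // geq_min le_c orbT.
Qed.

Lemma bmax_selects : selects (@bmax n).
Proof.
move=> C /set0Pn/card_gt0P C0.
by have [j] := @eq_bigmax_cond _ (mem C) (fun i : 'I_n => i : nat) C0; exists j.
Qed.

Lemma bmin_selects : selects (@bmin n).
Proof.
move=> C /set0Pn[c0 Cc0]; have [j Cj j_min] := @arg_minnP _ c0 (mem C) val Cc0.
exists j => //; apply/eqP; rewrite eqn_leq bmin_leq //=.
rewrite /bmin; elim/big_ind: _ => [|p q jp jq|i Ci]; first exact: ltnW.
- by rewrite leq_min jp.
- exact: j_min.
Qed.

Lemma rest_neq0 C j : C != set0 -> (rest C j != set0) = (j < bmax C)%N.
Proof.
move=> /bmax_selects[m Cm mE]; apply/set0Pn/idP => [[c]|lt_j].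
  by rewrite inE => /andP[/leq_bmax Cc jc]; apply: leq_trans Cc.
by exists m; rewrite inE Cm -mE.
Qed.

Lemma bmax_rest C j : rest C j != set0 -> bmax (rest C j) = bmax C.
Proof.
move=> r0; have C0 : C != set0.
  by apply: contraNneq r0 => ->; rewrite rest0.
have [m Cm mE] := bmax_selects C0; have [r + rE] := bmax_selects r0.
rewrite inE => /andP[Cr _]; apply/eqP; rewrite eqn_leq {1}rE leq_bmax //= mE.
by apply: leq_bmax; rewrite inE Cm -mE -rest_neq0.
Qed.
End Extrema.

(** * The statistics of a partition in terms of its blocks *)

Section Statistics.
Variables (n : nat) (P : {set {set 'I_n}}).
Hypothesis partP : partition P [set: 'I_n].
Implicit Types (C : {set 'I_n}) (i j k l : 'I_n).
Let s : mpart n := (P, set0).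

Lemma started_unmarked C i : started s C i = [exists c in C, (c < i)%N].
Proof. by rewrite /started inE. Qed.

Lemma bmin_lt C j : C \in P -> (bmin C < j)%N = started s C j.
Proof.
move=> PC; rewrite started_unmarked; apply/idP/existsP => [lt_j|[c /andP[Cc]]].
  have [m Cm mE] := bmin_selects (partition_neq0 partP PC).
  by exists m; rewrite Cm -mE.
by apply: leq_ltn_trans; apply: bmin_leq.
Qed.

Lemma own_block i : i \in pblock P i.
Proof. by rewrite mem_pblock (cover_partition partP) inE. Qed.

Lemma own_block_in i : pblock P i \in P.
Proof. by rewrite pblock_mem // (cover_partition partP) inE. Qed.

Lemma own_block_eq C i : C \in P -> i \in C -> pblock P i = C.
Proof. exact: def_pblock (partition_trivIset partP). Qed.

Lemma bmin_own i : (bmin (pblock P i) == i) = ~~ started s (pblock P i) i.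
Proof.
by rewrite -bmin_lt ?own_block_in // -leqNgt eqn_leq bmin_leq ?own_block.
Qed.

Lemma bmax_own i : (bmax (pblock P i) == i) = (rest (pblock P i) i == set0).
Proof.
apply: negb_inj; rewrite rest_neq0 ?(partition_neq0 partP) ?own_block_in //.
by rewrite neq_ltn ltnNge leq_bmax ?own_block.
Qed.

Lemma card_own_gt1 i : (1 < #|pblock P i|)%N =
  started s (pblock P i) i || (rest (pblock P i) i != set0).
Proof.
rewrite (cardsD1 i) own_block add1n ltnS started_unmarked.
apply/card_gt0P/orP => [[c]|].
  rewrite !inE => /andP[+ Bc].
  rewrite -(inj_eq val_inj) neq_ltn => /orP[lt_c|lt_c].
    by left; apply/existsP; exists c; rewrite Bc.
  by right; apply/set0Pn; exists c; rewrite inE Bc.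
case=> [/existsP[c /andP[Bc lt_c]]|/set0Pn[c]].
  by exists c; rewrite !inE Bc -(inj_eq val_inj) neq_ltn lt_c.
rewrite inE => /andP[Bc lt_c].
by exists c; rewrite !inE Bc -(inj_eq val_inj) neq_ltn lt_c orbT.
Qed.

Lemma openerE i : opener P i =
  ~~ started s (pblock P i) i && (rest (pblock P i) i != set0).
Proof.
by rewrite /opener card_own_gt1 bmin_own; case: started; rewrite ?andbF ?andbT.
Qed.

Lemma closerE i : closer P i =
  started s (pblock P i) i && (rest (pblock P i) i == set0).
Proof. by rewrite /closer card_own_gt1 bmax_own; case: started; case: eqP. Qed.

Lemma singletonE i : singleton P i =
  ~~ started s (pblock P i) i && (rest (pblock P i) i == set0).
Proof.
have B_gt0 : (0 < #|pblock P i|)%N by apply/card_gt0P; exists i; apply: own_block.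
have -> : singleton P i = ~~ (1 < #|pblock P i|)%N.
  by rewrite -leqNgt /singleton eqn_leq B_gt0 andbT.
by rewrite card_own_gt1 negb_or negbK.
Qed.

Lemma insiderE i : insider P i =
  started s (pblock P i) i && (rest (pblock P i) i != set0).
Proof.
have := card_own_gt1 i; rewrite /insider openerE closerE.
case st: started; case: eqP => rE; rewrite ?andbF //= ?andbT => card_gt1; last first.
  by apply/negbTE; apply: contraFN card_gt1; apply: ltnW.
have {rE}/set0Pn[k] : rest (pblock P i) i != set0 by apply/eqP.
move: st; rewrite started_unmarked inE => /existsP[h /andP[Bh hi]] /andP[Bk ik].
have hNi : h != i by apply: contraTneq hi => ->; rewrite ltnn.
have kNi : k != i by apply: contraTneq ik => ->; rewrite ltnn.
have kNh : k != h by apply: contraTneq (ltn_trans hi ik) => ->; rewrite ltnn.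
by rewrite (cardsD1 i) own_block (cardsD1 h) !inE hNi Bh (cardsD1 k) !inE kNh kNi Bk.
Qed.

Lemma edgeE i k : edge P i k =
  (rest (pblock P i) i != set0) && (bmin (rest (pblock P i) i) == k).
Proof.
apply/and3P/andP => [[ik Bk /forallP no_mid]|[r0 /eqP rE]].
  have rk : k \in rest (pblock P i) i by rewrite inE Bk.
  have r0 : rest (pblock P i) i != set0 by apply/set0Pn; exists k.
  split=> //; rewrite eqn_leq bmin_leq //= leqNgt; apply/negP.
  have [m + ->] := bmin_selects r0; rewrite inE => /andP[Bm im] mk.
  by have := no_mid m; rewrite im mk Bm.
have [m + mE] := bmin_selects r0; rewrite inE => /andP[Bm im].
have km : k = m by apply: val_inj; rewrite /= -rE mE.
rewrite km; split=> //; apply/forallP=> c; apply/implyP=> /andP[ic cm].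
by apply: contraL cm => Bc; rewrite -leqNgt -mE bmin_leq // inE Bc.
Qed.

(** The arcs over j correspond to the blocks passing over j: such a block has
    exactly one arc over j, from its last element before j to its first element
    after j. *)
Definition arcs_over j :=
  [set p : 'I_n * 'I_n | [&& p.1 < j, j < p.2 & edge P p.1 p.2]%N].

Lemma arc_target_block j p : p \in arcs_over j ->
  pblock P p.1 \in passing s j /\ bmin (rest (pblock P p.1) j) = p.2.
Proof.
case: p => i k; rewrite inE /= => /and3P[ij jk ik].
have /and3P[_ Bk /forallP no_mid] := ik; set B := pblock P i in Bk no_mid *.
have rk : k \in rest B j by rewrite inE Bk.
split.
  rewrite inE own_block_in started_unmarked; apply/and4P; split=> //.
  - by have := no_mid j; rewrite ij jk.
  - by apply/existsP; exists i; rewrite own_block.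
  - by apply/set0Pn; exists k.
apply/eqP; rewrite eqn_leq bmin_leq //= leqNgt; apply/negP.
have [|m + ->] := @bmin_selects _ (rest B j); first by apply/set0Pn; exists k.
rewrite inE => /andP[Bm jm] mk.
by have := no_mid m; rewrite (ltn_trans ij jm) mk Bm.
Qed.

Lemma passing_arc C j : C \in passing s j ->
  exists2 p, p \in arcs_over j & pblock P p.1 = C.
Proof.
rewrite inE started_unmarked => /and4P[PC Cj /existsP[h Ch] r0].
have [i /= /andP[Ci ij] i_max] :=
  @arg_maxnP _ h (fun c : 'I_n => (c \in C) && (c < j)%N) val Ch.
have [k + kE] := bmin_selects r0; rewrite inE => /andP[Ck jk].
have BC := own_block_eq PC Ci; exists (i, k) => //.
rewrite inE /= ij jk /edge BC Ck (ltn_trans ij jk) /=.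
apply/forallP=> c; apply/implyP=> /andP[ic ck].
apply: contraL ck => Cc; rewrite -leqNgt -kE bmin_leq // inE Cc ltn_neqAle.
have -> /= : (j : nat) != c by apply: contraNneq Cj => /val_inj->.
rewrite leqNgt; apply: contraL ic => cj; rewrite -leqNgt.
by apply: i_max; rewrite Cc.
Qed.

Lemma arc_block_inj j : {in arcs_over j &, injective (fun p => pblock P p.1)}.
Proof.
move=> [i k] [i' k'] pA p'A /= eqB.
have [_ /= kE] := arc_target_block pA; have [_ /= k'E] := arc_target_block p'A.
have kk' : k = k' by apply: val_inj; rewrite /= -kE eqB k'E.
congr (_, _) => //; apply: val_inj => /=.
wlog lt_ii' : i k i' k' pA p'A eqB kE k'E kk' / (i < i')%N => [gen|].
  have [|lt_i'i|//] := ltngtP i i'; first exact: (gen i k i' k').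
  by apply/esym; apply: (gen i' k' i k).
move: pA p'A; rewrite !inE /= => /and3P[_ _ /and3P[_ _ /forallP/(_ i')]].
rewrite lt_ii' eqB own_block implybF /= => i'k /and3P[_ _ /and3P[]].
by rewrite -kk' (negbTE i'k).
Qed.

(** With K := predT this counts qne; comparing the end of the arc with that of
    the arc starting at j gives cr and ne. *)
Lemma card_arcs_over j (K : pred nat) :
  #|[set p in arcs_over j | K p.2]| =
  #|[set C in passing s j | K (bmin (rest C j))]|.
Proof.
rewrite -(card_in_imset (f := fun p => pblock P p.1)); last first.
  by move=> p q /setIdP[pA _] /setIdP[qA _]; apply: (arc_block_inj pA qA).
apply: eq_card => C; rewrite [RHS]inE; apply/imsetP/andP.
  by case=> p /setIdP[/arc_target_block[pC kE] Kp] ->; rewrite kE.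
case=> /passing_arc[p pA <-]; have [_ ->] := arc_target_block pA => Kp.
by exists p; rewrite // inE pA.
Qed.

Lemma qneE j : qne P j = #|passing s j|.
Proof.
transitivity #|[set p in arcs_over j | predT (p.2 : nat)]|.
  by apply: eq_card => -[i k]; rewrite !inE /= andbT.
by rewrite (card_arcs_over j predT); apply: eq_card => C; rewrite inE andbT.
Qed.

(** The four statistics of an element j with a successor in its block, as at
    openers and insiders.  For cr and ne, the arc starting at j is determined by
    j, so the triples reduce to arcs over j.  For ov and cov, the block B2 is
    that of j, and a block B1 whose maximum differs from that of B2 cannot
    contain j. *)
Section NonMaximal.
Variable j : 'I_n.
Hypothesis rest_j : rest (pblock P j) j != set0.

Lemma crE : cr P j = #|before (@bmin n) s j|.
Proof.
rewrite -(card_arcs_over j (fun m => m < bmin (rest (pblock P j) j))%N).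
have [l _ lE] := bmin_selects rest_j.
pose f (p : 'I_n * 'I_n) := (p.1, p.2, l).
rewrite -(card_imset (f := f)) => [|[i k] [i' k'] [-> ->] //].
apply: eq_card => -[[i k] l']; rewrite inE; apply/and5P/imsetP.
  case=> ij jk kl ik; rewrite edgeE rest_j lE /= => /eqP/val_inj ll'.
  by exists (i, k); rewrite /f ?ll' // !inE /= ij jk ik kl.
case=> -[i' k'] /setIdP[]; rewrite inE => /and3P[ij jk ik] kl [-> -> ->].
by split=> //; [rewrite -lE | rewrite edgeE rest_j lE eqxx].
Qed.

Lemma neE : ne P j = #|behind (@bmin n) s j|.
Proof.
rewrite -(card_arcs_over j (fun m => bmin (rest (pblock P j) j) < m)%N).
have [l + lE] := bmin_selects rest_j; rewrite inE => /andP[_ jl].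
pose f (p : 'I_n * 'I_n) := (p.1, l, p.2).
rewrite -(card_imset (f := f)) => [|[i k] [i' k'] [-> ->] //].
apply: eq_card => -[[i l'] k]; rewrite inE; apply/and5P/imsetP.
  case=> ij jl' lk ik; rewrite edgeE rest_j lE /= => /eqP/val_inj ll'.
  by exists (i, k); rewrite /f ?ll' // !inE /= ij ik lk (ltn_trans jl').
case=> -[i' k'] /setIdP[]; rewrite inE => /and3P[ij jk ik] kl [-> -> ->].
by split=> //; [rewrite -lE | rewrite edgeE rest_j lE eqxx].
Qed.

Lemma ovE : ov P j = #|before (@bmax n) s j|.
Proof.
rewrite -(card_imset (f := fun C => (C, pblock P j))) => [|C C' [] //].
apply: eq_card => -[C B]; rewrite inE; apply/idP/imsetP.
  case/and5P=> PC PB Bj; rewrite bmin_lt // => Cj /andP[jC CB].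
  have BE := own_block_eq PB Bj; exists C; rewrite ?BE // !inE PC Cj.
  have r0 : rest C j != set0 by rewrite rest_neq0 ?(partition_neq0 partP).
  rewrite r0 !bmax_rest // BE CB !andbT /=.
  by apply: contraTN CB => /(own_block_eq PC) <-; rewrite BE ltnn.
case=> C'; rewrite !inE /= => /andP[/and4P[PC _ Cj r0] CB] [-> ->].
rewrite !bmax_rest // in CB.
rewrite PC own_block_in own_block bmin_lt // Cj.
by rewrite -rest_neq0 ?r0 ?(partition_neq0 partP).
Qed.

Lemma covE : cov P j = #|behind (@bmax n) s j|.
Proof.
have jB : (j < bmax (pblock P j))%N.
  by rewrite -rest_neq0 ?(partition_neq0 partP (own_block_in j)).
rewrite -(card_imset (f := fun C => (C, pblock P j))) => [|C C' [] //].
apply: eq_card => -[C B]; rewrite inE; apply/idP/imsetP.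
  case/and5P=> PC PB Bj; rewrite bmin_lt // => Cj /andP[jB' BC].
  have BE := own_block_eq PB Bj; exists C; rewrite ?BE // !inE PC Cj.
  have r0 : rest C j != set0.
    by rewrite rest_neq0 ?(partition_neq0 partP) ?(ltn_trans jB').
  rewrite r0 !bmax_rest // BE BC !andbT /=.
  by apply: contraTN BC => /(own_block_eq PC) <-; rewrite BE ltnn.
case=> C'; rewrite !inE /= => /andP[/and4P[PC _ Cj r0] CB] [-> ->].
rewrite !bmax_rest // in CB.
by rewrite PC own_block_in own_block bmin_lt // Cj jB.
Qed.
End NonMaximal.

(** The four kinds of elements partition [n] according to whether the block of i
    has elements on its left and on its right. *)
Lemma prod_weight (R : comNzRingType) key_a key_d (a : nat -> nat -> R) b d e :
  \prod_i weight key_a key_d a b d e s i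
  = (\prod_(i | opener P i) a #|before key_a s i| #|behind key_a s i|) *
    (\prod_(i | closer P i) b (qne P i)) *
    (\prod_(i | insider P i) d #|before key_d s i| #|behind key_d s i|) *
    (\prod_(i | singleton P i) e (qne P i)).
Proof.
rewrite [X in X * _ * _ * _]big_mkcond [X in _ * X * _ * _]big_mkcond.
rewrite [X in _ * X * _]big_mkcond [X in _ * X]big_mkcond -!big_split /=.
apply: eq_bigr => i _; rewrite openerE closerE insiderE singletonE qneE /weight /=.
by case: started; case: eqP => _; rewrite /= ?mulr1 ?mul1r.
Qed.
End Statistics.

Lemma sum_prod_weight (R : comNzRingType) n key_a key_d (a : nat -> nat -> R) b d e :
  @selects n key_a -> @selects n key_d ->
  \sum_(P in set_partitions n) \prod_i weight key_a key_d a b d e (P, set0) i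
  = motzkin (star a) b (gamma_coef d e) 0 n 0.
Proof.
by move=> sel_a sel_d; rewrite -total0 total_motzkin // subn0.
Qed.

(** * The three polynomials *)

Section Polynomials.
Variables (R : comNzRingType) (a : nat -> nat -> R) (b : nat -> R).
Variables (d : nat -> nat -> R) (e : nat -> R) (n : nat).

Lemma Bpoly_motzkin : Bpoly a b d e n = motzkin (star a) b (gamma_coef d e) 0 n 0.
Proof.
rewrite -(sum_prod_weight a b d e (@bmin_selects n) (@bmin_selects n)).
apply: eq_bigr => P; rewrite inE => partP; rewrite prod_weight //.
congr (_ * _ * _ * _); apply: eq_bigr => i.
  by rewrite openerE // => /andP[_ r0]; rewrite crE ?neE.
by rewrite insiderE // => /andP[_ r0]; rewrite crE ?neE.
Qed.

Lemma Bpoly3_motzkin : Bpoly3 a b d e n = motzkin (star a) b (gamma_coef d e) 0 n 0.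
Proof.
rewrite -(sum_prod_weight a b d e (@bmax_selects n) (@bmin_selects n)).
apply: eq_bigr => P; rewrite inE => partP; rewrite prod_weight //.
congr (_ * _ * _ * _); apply: eq_bigr => i.
  by rewrite openerE // => /andP[_ r0]; rewrite ovE ?covE.
by rewrite insiderE // => /andP[_ r0]; rewrite crE ?neE.
Qed.

Lemma Bpoly4_motzkin : Bpoly4 a b d e n = motzkin (star a) b (gamma_coef d e) 0 n 0.
Proof.
rewrite -(sum_prod_weight a b d e (@bmin_selects n) (@bmax_selects n)).
apply: eq_bigr => P; rewrite inE => partP; rewrite prod_weight //.
congr (_ * _ * _ * _); apply: eq_bigr => i.
  by rewrite openerE // => /andP[_ r0]; rewrite crE ?neE.
by rewrite insiderE // => /andP[_ r0]; rewrite ovE ?covE.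
Qed.
End Polynomials.

Theorem theorem3p13 (R : comNzRingType)
    (a : nat -> nat -> R) (b : nat -> R) (d : nat -> nat -> R) (e : nat -> R) :
  (forall n : nat,
     Bpoly3 a b d e n = Bpoly4 a b d e n /\ Bpoly4 a b d e n = Bpoly a b d e n)
  /\ is_jfrac (gamma_coef d e) (beta_coef a b) (Bpoly3 a b d e)
  /\ is_jfrac (gamma_coef d e) (beta_coef a b) (Bpoly4 a b d e).
Proof.
have jfrac := @motzkin_jfrac R (star a) b (gamma_coef d e) (beta_coef a b)
  (fun=> erefl).
split; first by move=> n; rewrite Bpoly3_motzkin Bpoly4_motzkin Bpoly_motzkin.
by split=> n; have [M convM] := jfrac n; exists M => m /convM->;
  rewrite (Bpoly3_motzkin, Bpoly4_motzkin).
Qed.
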